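(* Let $G$ be a finite group and let $M$ be a left $\mathbb{Z}G$-module. Then $M$ is a Gorenstein projective left $\mathbb{Z}G$-module if and only if the underlying $\mathbb{Z}$-module $M$ is Gorenstein projective.
   Context: $\mathbb{Z}G$ is the integral group ring. For a ring $S$, a left $S$-module $M$ (not necessarily finitely generated) is Gorenstein projective if there is an acyclic complex $\mathbf{P}=\cdots\to P_1\to P_0\to P_{-1}\to\cdots$ of projective left $S$-modules such that $\mathrm{Hom}_S(\mathbf{P},P)$ is acyclic for every projective left $S$-module $P$, with $M=\mathrm{Ker}(P_0\to P_{-1})$. *)

(* Defs.v *)
From HB Require Import structures.
From mathcomp Require Import all_boot all_order all_algebra all_fingroup.

Set Implicit Arguments.
Unset Strict Implicit.
Unset Printing Implicit Defensive.

Import GRing.Theory.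
Local Open Scope ring_scope.

(* The integral group ring Z[G] of a finite group G: a is the formal sum
   \sum_g (a g) g.  It is a separate constant because {ffun gT -> int} already
   carries the pointwise product, whereas the product here is convolution. *)
Definition group_ring (gT : finGroupType) : Type := {ffun gT -> int}.

Section GroupRing.
Variable gT : finGroupType.
Implicit Types a b c : group_ring gT.

HB.instance Definition _ := GRing.Zmodule.copy (group_ring gT) {ffun gT -> int}.

Definition group_ring_one : group_ring gT := [ffun g => (g == 1%g)%:R].

Definition group_ring_mul a b : group_ring gT :=
  [ffun g => \sum_(h : gT) a h * b (h^-1 * g)%g].

Fact group_ring_mulA : associative group_ring_mul.
Proof.
move=> a b c; apply/ffunP => g; rewrite !ffunE.
under eq_bigr => h _ do rewrite ffunE mulr_sumr.
under [RHS]eq_bigr => k _ do rewrite ffunE mulr_suml.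
rewrite [RHS]exchange_big /=; apply: eq_bigr => h _.
rewrite [RHS](reindex_inj (mulgI h)) /=; apply: eq_bigr => k _.
by rewrite mulKg invMg !mulgA mulrA.
Qed.

Fact group_ring_mul1r : left_id group_ring_one group_ring_mul.
Proof.
move=> a; apply/ffunP => g; rewrite ffunE (bigD1 1%g) //= big1 => [|h /negPf h1].
  by rewrite ffunE eqxx mul1r invg1 mul1g addr0.
by rewrite ffunE h1 mul0r.
Qed.

Fact group_ring_mulr1 : right_id group_ring_one group_ring_mul.
Proof.
move=> a; apply/ffunP => g; rewrite ffunE (bigD1 g) //= big1 => [|h hg].
  by rewrite ffunE mulVg eqxx mulr1 addr0.
by rewrite ffunE -eq_mulVg1 (negPf hg) mulr0.
Qed.

Fact group_ring_mulDl : left_distributive group_ring_mul +%R.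
Proof.
move=> a b c; apply/ffunP => g; rewrite !ffunE -big_split /=.
by apply: eq_bigr => h _; rewrite ffunE mulrDl.
Qed.

Fact group_ring_mulDr : right_distributive group_ring_mul +%R.
Proof.
move=> a b c; apply/ffunP => g; rewrite !ffunE -big_split /=.
by apply: eq_bigr => h _; rewrite ffunE mulrDr.
Qed.

Fact group_ring_oner_neq0 : group_ring_one != 0.
Proof. by apply/eqP => /ffunP/(_ 1%g); rewrite !ffunE eqxx. Qed.

HB.instance Definition _ := GRing.Zmodule_isNzRing.Build (group_ring gT)
  group_ring_mulA group_ring_mul1r group_ring_mulr1 group_ring_mulDl
  group_ring_mulDr group_ring_oner_neq0.

End GroupRing.

Section GorensteinProjective.
Variable S : pzRingType.

Definition projective (P : lmodType S) : Prop :=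
  forall (N N' : lmodType S) (p : {linear N -> N'}) (f : {linear P -> N'}),
    (forall y, exists x, p x = y) ->
    exists g : {linear P -> N}, forall x, p (g x) = f x.

(* Quantifying over i, this is exactness at the term P (i - 1), hence at every
   term of the complex; d o d = 0 is the right-to-left implication. *)
Definition acyclic (P : int -> lmodType S)
    (d : forall i, {linear P i -> P (i - 1)}) : Prop :=
  forall i (y : P (i - 1)), d (i - 1) y = 0 <-> exists x : P i, d i x = y.

(* Acyclicity of Hom_S(P, Q), whose differentials are precomposition with d:
   exactness at Hom_S(P (i - 1), Q), for every i. *)
Definition Hom_acyclic (P : int -> lmodType S)
    (d : forall i, {linear P i -> P (i - 1)}) (Q : lmodType S) : Prop :=
  forall i (f : {linear P (i - 1) -> Q}),
    (forall x : P i, f (d i x) = 0) <->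
    exists g : {linear P (i - 1 - 1) -> Q}, forall y, g (d (i - 1) y) = f y.

(* M = Ker(P_0 -> P_(-1)) is read up to isomorphism: M embeds linearly in P 0
   with image this kernel. *)
Definition gorenstein_projective (M : lmodType S) : Prop :=
  exists (P : int -> lmodType S) (d : forall i, {linear P i -> P (i - 1)}),
    [/\ forall i, projective (P i),
        acyclic d,
        forall Q : lmodType S, projective Q -> Hom_acyclic d Q
      & exists iota : {linear M -> P 0},
          injective iota /\
          forall y : P 0, d 0 y = 0 <-> exists x : M, iota x = y].

End GorensteinProjective.

(* zmodule M is the carrier of M with the scaling n *: x = x *~ n of int, which
   is the restriction of scalars of M along int -> S (see scaler_int). *)
Definition underlying_Zmodule (S : pzRingType) (M : lmodType S) : lmodType int :=
  zmodule M.

(* Main.v *)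
From HB Require Import structures.
Require Import Defs.
From mathcomp Require Import all_boot all_order all_algebra all_fingroup.
From mathcomp Require Import boolp classical_sets freeg.

(** Write ZG for the integral group ring and, for an abelian group N, let
    coind N be the ZG-module of functions from G to N, with (h phi)(g) =
    phi(g h).  It is coinduced from N, so that additive maps P -> N correspond
    to ZG-linear maps P -> coind N ([coind_adj]); since G is finite it is also
    induced from N, so that additive maps N -> L extend to ZG-linear maps
    coind N -> L ([coind_ext]).  The first property shows that ZG-projective
    modules are Z-projective ([restriction_projective]), the second that coind
    preserves projectivity ([coind_projective]).

    From ZG to Z ([restriction_gorenstein]): the restriction of a totally
    acyclic complex P is an acyclic complex of Z-projectives, and the complexes
    Hom_Z(P, Q) and Hom_ZG(P, coind Q) are isomorphic, where coind Q is
    projective when Q is.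

    From Z to ZG: a subgroup of a projective abelian group is projective
    ([submodule_Zprojective]), so a Gorenstein projective Z-module M, which
    embeds in a projective, is projective.  It remains to resolve a ZG-module M
    that is Z-projective.  The counit coind M -> M is onto and the unit
    M -> coind M is injective; the middle term is ZG-projective, while the
    kernel of the former and the cokernel of the latter embed in coinduced
    modules, hence are Z-projective again.  Iterating in both directions and
    splicing gives an acyclic complex of projectives.  Such a complex is totally
    acyclic ([acyclic_Hom_acyclic]): its images are Z-projective, so over Z it
    is split, and a projective ZG-module Q is a direct summand of coind Q, which
    turns additive extensions of maps into ZG-linear ones
    ([extension_through_split]). *)

Set Implicit Arguments.
Unset Strict Implicit.
Unset Printing Implicit Defensive.

Import GRing.Theory Num.Theory.
Local Open Scope ring_scope.

(** * Linear maps, kernels and images *)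

Lemma subrACA (V : zmodType) (x y a b : V) :
  (x - y) - (a - b) = (x - a) - (y - b).
Proof. by rewrite !opprB ![b - _]addrC addrACA. Qed.

Definition bundle_linear (S : pzRingType) (U V : lmodType S) (f : U -> V)
    (fP : linear f) : {linear U -> V} :=
  HB.pack f (GRing.isLinear.Build S U V *:%R f fP).

Lemma zmod_morphism_linear (U V : lmodType int) (f : U -> V) :
  zmod_morphism f -> linear f.
Proof.
move=> fB; pose F : {additive U -> V} :=
  HB.pack f (GRing.isZmodMorphism.Build U V f fB).
by move=> a x y; rewrite -[f]/(F : U -> V) raddfD raddf_int_scalable.
Qed.

Definition bundle_int (U V : lmodType int) (f : U -> V)
    (fP : zmod_morphism f) : {linear U -> V} :=
  bundle_linear (zmod_morphism_linear fP).

Definition zlinear (U V : zmodType) (f : {additive U -> V}) :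
    {linear zmodule U -> zmodule V} :=
  @bundle_int (zmodule U) (zmodule V) f (raddfB f).

Section Submodule.
Variables (S : pzRingType) (V : lmodType S) (A : V -> bool).
Hypothesis A_closed : submod_closed A.

(** Indexing the predicate by its closure proof gives structure inference a
    constant to attach that proof to. *)
Definition submodule_pred of submod_closed A := A.

HB.instance Definition _ :=
  GRing.isSubmodClosed.Build S V (submodule_pred A_closed) A_closed.

Record submodule := Submodule {
  submodule_val : V;
  submodule_valP : submodule_val \in submodule_pred A_closed }.

HB.instance Definition _ := [isSub for submodule_val].
HB.instance Definition _ := [Choice of submodule by <:].
HB.instance Definition _ := [SubChoice_isSubLmodule of submodule by <:].

End Submodule.

Section KernelImage.
Variables (S : pzRingType) (U V : lmodType S) (f : {linear U -> V}).

Fact kernel_closed : submod_closed (fun x => f x == 0).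
Proof.
split; first by rewrite unfold_in linear0.
move=> a x y /eqP fx0 /eqP fy0; apply/eqP.
by rewrite linearP fx0 fy0 scaler0 addr0.
Qed.

Fact image_closed : submod_closed (fun y => `[< exists x, f x = y >]).
Proof.
split; first by apply/asboolP; exists 0; rewrite linear0.
move=> a _ _ /asboolP[x <-] /asboolP[y <-].
by apply/asboolP; exists (a *: x + y); rewrite linearP.
Qed.

Definition lin_kernel : lmodType S := submodule kernel_closed.
Definition lin_image : lmodType S := submodule image_closed.

Definition kernel_incl : {linear lin_kernel -> U} :=
  (\val : submodule kernel_closed -> U).
Definition image_incl : {linear lin_image -> V} :=
  (\val : submodule image_closed -> V).

Lemma kernel_incl_inj : injective kernel_incl.
Proof. exact: val_inj. Qed.

Lemma image_incl_inj : injective image_incl.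
Proof. exact: val_inj. Qed.

Lemma kernel_inclP x : f x = 0 <-> exists y, kernel_incl y = x.
Proof.
split=> [/eqP fx0|[y <-]].
  by exists (Submodule (A_closed := kernel_closed) fx0).
exact/eqP/(submodule_valP y).
Qed.

Lemma image_factor (P : lmodType S) (g : {linear P -> V}) :
  (forall x, exists y, f y = g x) ->
  exists h : {linear P -> lin_image}, forall x, image_incl (h x) = g x.
Proof.
move=> fg; pose h x : lin_image :=
  Submodule (A_closed := image_closed) (introT (asboolP _) (fg x)).
have hP : linear h by move=> a x y; apply: val_inj; exact: (linearP g).
by exists (bundle_linear hP).
Qed.

Lemma image_corestr : exists2 h : {linear U -> lin_image},
  forall x, image_incl (h x) = f x & forall y, exists x, h x = y.
Proof.
have [|h hE] := @image_factor U f; first by move=> x; exists x.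
exists h => // y; have /asboolP[x fx] := submodule_valP y.
by exists x; apply: val_inj; rewrite -[RHS]fx; exact: hE.
Qed.

End KernelImage.

(** Lifting along D needs no surjectivity onto B: its image suffices as the
    target. *)
Lemma projective_lift (S : pzRingType) (P A B : lmodType S)
    (D : {linear A -> B}) (f : {linear P -> B}) :
  projective P -> (forall x, exists a, D a = f x) ->
  exists g : {linear P -> A}, forall x, D (g x) = f x.
Proof.
move=> projP Df; have [f' f'E] := image_factor Df.
have [D' D'E D'surj] := image_corestr D.
have [g gE] := projP _ _ D' f' D'surj.
by exists g => x; rewrite -D'E gE f'E.
Qed.

(** * Subgroups of projective abelian groups *)

(** M is given with coordinates c x : M -> Z that are jointly injective and
    almost all zero on each element, as on a subgroup of a free abelian group
    with basis K.  A map f : M -> N' is lifted along p : N -> N' by Zorn's lemma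
    on partial lifts, defined on the elements of M whose coordinates vanish off
    a subset of K.  Enlarging that subset by one index is possible because the
    values of a single coordinate form an ideal of Z, which is principal. *)
Section PartialLifts.
Variables (K : eqType) (M N N' : lmodType int) (c : K -> {linear M -> int^o}).
Variables (p : {linear N -> N'}) (f : {linear M -> N'}).

Definition supported (Y : set K) (m : M) : Prop :=
  forall x, c x m != 0 -> Y x.

Record partial_lift := PartialLift {
  support_set : set K;
  lift_fun : M -> N;
  lift_funB : forall m m',
    supported support_set m -> supported support_set m' ->
    lift_fun (m - m') = lift_fun m - lift_fun m';
  lift_funE : forall m, supported support_set m -> p (lift_fun m) = f m }.

Definition lift_le (t t' : partial_lift) : Prop :=
  (support_set t `<=` support_set t')%classic /\
  forall m, supported (support_set t) m -> lift_fun t' m = lift_fun t m.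

Lemma supportedS (Y Y' : set K) m :
  (Y `<=` Y')%classic -> supported Y m -> supported Y' m.
Proof. by move=> sYY' Ym x /Ym; exact: sYY'. Qed.

Lemma supportedB Y m m' :
  supported Y m -> supported Y m' -> supported Y (m - m').
Proof.
move=> Ym Ym' x; have [cm0|cm _] := eqVneq (c x m) 0; last exact: Ym.
by rewrite linearB /= cm0 sub0r oppr_eq0; exact: Ym'.
Qed.

Lemma supportedZ Y k m : supported Y m -> supported Y (k *: m).
Proof.
move=> Ym x cm; apply: Ym; apply: contraNneq cm => cm0.
by rewrite linearZ /= cm0 scaler0.
Qed.

Lemma lift_le_refl t : lift_le t t.
Proof. by split. Qed.

Lemma lift_le_trans r s t : lift_le r s -> lift_le s t -> lift_le r t.
Proof.
move=> [rs rsE] [st stE]; split; first exact: classical_sets.subset_trans st.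
by move=> m rm; rewrite stE ?rsE //; exact: supportedS rm.
Qed.

Hypothesis c_finite :
  forall m, exists s : seq K, forall x, c x m != 0 -> x \in s.

(** Finiteness of the support makes the domain of the union of a chain the
    union of the domains. *)
Lemma supported_chain (A : set partial_lift) t0 m :
  A t0 -> total_on A lift_le ->
  supported (fun x => exists2 t, A t & support_set t x) m ->
  exists2 t, A t & supported (support_set t) m.
Proof.
move=> At0 totA mU; have [s sP] := c_finite m.
suff [t At tP] :
    exists2 t, A t & forall x, x \in s -> c x m != 0 -> support_set t x.
  by exists t => // x cx; exact: tP (sP _ cx) cx.
elim: s {sP} => [|x s [t At tP]]; first by exists t0.
have [cx0|/[dup] cx /mU [u Au ux]] := eqVneq (c x m) 0.
  exists t => // y; rewrite inE => /predU1P[->|]; last exact: tP.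
  by rewrite cx0 eqxx.
have [[tu _]|[ut _]] := totA _ _ At Au.
  by exists u => // y; rewrite inE => /predU1P[->//|ys cy]; exact/tu/tP.
by exists t => // y; rewrite inE => /predU1P[-> _|]; [exact: ut|exact: tP].
Qed.

Lemma lift_chain_bounded (A : set partial_lift) t0 :
  A t0 -> total_on A lift_le -> exists t, forall s, A s -> lift_le s t.
Proof.
move=> At0 totA; pose Y x := exists2 t, A t & support_set t x.
have leY t : A t -> (support_set t `<=` Y)%classic by move=> At x tx; exists t.
have /choice[g gP] : forall m, exists n, forall t, A t ->
    supported (support_set t) m -> n = lift_fun t m.
  move=> m; have [[t [At tm]]|no] :=
    pselect (exists t, A t /\ supported (support_set t) m); last first.
    by exists 0 => t At tm; case: no; exists t.
  exists (lift_fun t m) => u Au um.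
  by have [[_ ->]|[_ ->]] := totA _ _ At Au.
have chain m : supported Y m -> exists2 t, A t & supported (support_set t) m.
  exact: supported_chain At0 totA.
have gB m m' : supported Y m -> supported Y m' -> g (m - m') = g m - g m'.
  move=> /chain[t At tm] /chain[u Au um'].
  have [v [Av vm vm']] : exists v, [/\ A v, supported (support_set v) m &
      supported (support_set v) m'].
    have [[tu _]|[ut _]] := totA _ _ At Au.
      by exists u; split => //; exact: supportedS tm.
    by exists t; split => //; exact: supportedS um'.
  rewrite (gP _ v Av vm) (gP _ v Av vm') (gP _ v Av) ?lift_funB //.
  exact: supportedB.
have gE m : supported Y m -> p (g m) = f m.
  by move=> /chain[t At tm]; rewrite (gP _ t At tm) lift_funE.
exists (PartialLift gB gE) => t At; split => /= [|m tm]; first exact: leY.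
exact: gP.
Qed.

Hypothesis p_surj : forall y, exists x, p x = y.

(** On the elements supported on the domain of t and x, the x-th coordinate
    takes values in the multiples of its value at some m0.  Hence each such m
    differs by a multiple of m0 from an element where t is defined, and the lift
    extends by sending m0 to any preimage of f m0. *)
Lemma lift_extend t x : exists2 u, lift_le t u & support_set u x.
Proof.
have [tx|ntx] := pselect (support_set t x).
  by exists t => //; exact: lift_le_refl.
pose Y' y := support_set t y \/ y = x.
have tY' : (support_set t `<=` Y')%classic by move=> y; left.
have [m0 [Y'm0 m0P]] : exists m0, supported Y' m0 /\
    forall m, supported Y' m -> (c x m0 %| c x m)%Z.
  have [all0|/existsNP[m1 /not_implyP[Y'm1 /eqP cm1]]] :=
      pselect (forall m, supported Y' m -> c x m = 0).
    exists 0; split=> [y|m /all0 ->]; first by rewrite linear0 eqxx.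
    by rewrite dvdz0.
  (* m0 minimizes the absolute value of a nonzero x-th coordinate. *)
  have ex : exists k,
      `[< exists m, [/\ supported Y' m, c x m != 0 & `|c x m|%N = k] >].
    by exists `|c x m1|%N; apply/asboolP; exists m1.
  case: (ex_minnP ex) => k /asboolP[m0 [Y'm0 cm0 <-]] kmin.
  exists m0; split => // m Y'm; apply/dvdz_mod0P/eqP; apply/negPn/negP => r0.
  have := kmin `|c x m %% c x m0|%Z%N; apply/implyP; rewrite negb_imply.
  apply/andP; split; last first.
    by rewrite -ltnNge -ltz_nat !abszE (ger0_norm (modz_ge0 _ cm0)) ltz_mod.
  apply/asboolP; exists (m - (c x m %/ c x m0)%Z *: m0); split => //.
  - by apply: supportedB => //; exact: supportedZ.
  - by rewrite linearB linearZ.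
  - by rewrite linearB linearZ.
have [n0 n0E] := p_surj (f m0).
(* If the x-th coordinate is identically zero, so is k, as m %/ 0 = 0. *)
pose k m := (c x m %/ c x m0)%Z.
have kB m m' : supported Y' m -> supported Y' m' -> k (m - m') = k m - k m'.
  move=> Y'm Y'm'; apply/eqP; rewrite eq_sym subr_eq /k -divzDl ?m0P //.
    by rewrite -linearD subrK.
  exact: supportedB.
have tk m : supported Y' m -> supported (support_set t) (m - k m *: m0).
  move=> Y'm y; have [->|yx] := eqVneq y x.
    by rewrite linearB linearZ /= [_ *: _]divzK ?m0P // subrr eqxx.
  have Y'mk : supported Y' (m - k m *: m0).
    by apply: supportedB => //; exact: supportedZ.
  by move=> /Y'mk[//|yx']; rewrite yx' eqxx in yx.
pose g m := lift_fun t (m - k m *: m0) + k m *: n0.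
have gB m m' : supported Y' m -> supported Y' m' -> g (m - m') = g m - g m'.
  move=> Y'm Y'm'; rewrite /g kB // scalerBl subrACA.
  by rewrite lift_funB; [rewrite scalerBl opprD addrACA|exact: tk..].
have gE m : supported Y' m -> p (g m) = f m.
  move=> Y'm; rewrite /g linearD [p (_ *: _)]linearZ /= n0E.
  rewrite lift_funE; last exact: tk.
  by rewrite linearB [f (_ *: _)]linearZ subrK.
exists (PartialLift gB gE); last by right.
split => //= m tm; have km0 : k m = 0.
  by rewrite /k; have [->|/tm//] := eqVneq (c x m) 0; exact: div0z.
by rewrite /g km0 !scale0r subr0 addr0.
Qed.

Hypothesis c_separating : forall m, (forall x, c x m = 0) -> m = 0.

Lemma coordinates_lift : exists g : {linear M -> N}, forall m, p (g m) = f m.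
Proof.
have E0 m : supported set0 m -> p 0 = f m.
  move=> m0; have -> : m = 0; last by rewrite !linear0.
  by apply: c_separating => x; apply/eqP/negPn/negP => /m0.
pose t0 := @PartialLift set0 (fun=> 0) (fun _ _ _ _ => esym (subr0 0)) E0.
have [r|r s t /asboolP rs /asboolP st|A totA|t tmax] :=
    @ZL_preorder _ t0 (fun s t => `[< lift_le s t >]).
- by apply/asboolP; exact: lift_le_refl.
- by apply/asboolP; exact: lift_le_trans rs st.
- have [[s As]|no] := pselect (exists s, A s); last first.
    by exists t0 => s As; case: no; exists s.
  have [|t tP] := @lift_chain_bounded A s As.
    move=> u v Au Av.
    by have [/asboolP|/asboolP] := totA _ _ Au Av; [left|right].
  by exists t => u Au; apply/asboolP; exact: tP.
have tT m : supported (support_set t) m.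
  move=> x _; have [u /asboolP tu ux] := lift_extend t x.
  by have /asboolP[ut _] := tmax u tu; exact: ut.
exists (bundle_int (fun m m' => lift_funB (tT m) (tT m'))) => m.
exact: lift_funE.
Qed.

End PartialLifts.

Lemma subfree_projective (K : choiceType) (M : lmodType int)
  (e : {linear M -> {freeg K / int}}) : injective e -> projective M.
Proof.
move=> e_inj N N' p f p_surj.
have cP x : linear ((fun m => coeff x (e m)) : M -> int^o).
  by move=> a m m'; rewrite linearP coeffD coeffZ.
apply: (@coordinates_lift K M N N' (fun x => bundle_linear (cP x))) => //.
- by move=> m; exists (dom (e m)) => x; rewrite mem_dom.
- move=> m m0; apply: e_inj; rewrite linear0; apply/eqP/freeg_eqP => x.
  by rewrite coeff0; exact: m0.
Qed.

(** A projective P is a direct summand of the free abelian group on its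
    elements, which reduces the claim to subgroups of free groups. *)
Lemma submodule_Zprojective (M P : lmodType int) (e : {linear M -> P}) :
  injective e -> projective P -> projective M.
Proof.
move=> e_inj projP.
have evB : zmod_morphism (@fglift int P P id).
  by move=> x y; exact: lift_is_additive.
have [|s sP] := projP _ _ (bundle_int evB) (bundle_linear (linearP idfun)).
  by move=> y; exists << y >>; rewrite [LHS]liftU scale1r.
pose se := (s : {linear P -> {freeg P / int}}) \o e.
by apply: (@subfree_projective P M se); exact: inj_comp (can_inj sP) e_inj.
Qed.

Lemma gorenstein_Zprojective (M : lmodType int) :
  gorenstein_projective M -> projective M.
Proof.
case=> P [d [projP _ _ [iota [iota_inj _]]]].
exact: submodule_Zprojective iota_inj (projP 0).
Qed.

(** * Group elements in the group ring *)

Section GroupElements.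
Variable gT : finGroupType.
Implicit Types (g h : gT) (a b : group_ring gT).

Definition group_elt h : group_ring gT := [ffun g => (g == h)%:R].

Lemma group_elt1 : group_elt 1%g = 1.
Proof. by []. Qed.

Lemma group_eltM g h : group_elt (g * h)%g = group_elt g * group_elt h.
Proof.
apply/ffunP => k; rewrite !ffunE (bigD1 g) //= big1 => [|l /negPf lg].
  by rewrite !ffunE eqxx mul1r addr0 -[in RHS](inj_eq (mulgI g)) mulKVg.
by rewrite ffunE lg mul0r.
Qed.

Lemma group_ring_sum a : a = \sum_h group_elt h *~ a h.
Proof.
apply/ffunP => g; rewrite sum_ffunE (bigD1 g) //= big1 => [|h hg].
  by rewrite ffunMzE ffunE eqxx addr0 intz.
by rewrite ffunMzE ffunE eq_sym (negPf hg) mul0rz.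
Qed.

Lemma scale_group_ring (M : lmodType (group_ring gT)) a (x : M) :
  a *: x = \sum_h (group_elt h *: x) *~ a h.
Proof.
rewrite {1}[a]group_ring_sum scaler_suml.
by apply: eq_bigr => h _; rewrite scalerMzl.
Qed.

Lemma equivariant_linear (M N : lmodType (group_ring gT)) (f : M -> N) :
  zmod_morphism f ->
  (forall h x, f (group_elt h *: x) = group_elt h *: f x) -> linear f.
Proof.
move=> fB fG; pose F : {additive M -> N} :=
  HB.pack f (GRing.isZmodMorphism.Build M N f fB).
move=> a x y; rewrite -[f]/(F : M -> N) raddfD; congr (_ + _).
rewrite !scale_group_ring raddf_sum; apply: eq_bigr => h _.
by rewrite raddfMz; congr (_ *~ _); exact: fG.
Qed.

End GroupElements.

(** * Coinduced modules *)

Definition coind (gT : finGroupType) (N : zmodType) : Type := {ffun gT -> N}.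

Section Coinduction.
Variables (gT : finGroupType) (N : zmodType).
Implicit Types (a b : group_ring gT) (g h : gT) (phi psi : coind gT N).

HB.instance Definition _ := GRing.Zmodule.copy (coind gT N) {ffun gT -> N}.

Definition coind_scale a phi : coind gT N :=
  [ffun g => \sum_h phi (g * h)%g *~ a h].

Fact coind_scaleA a b phi :
  coind_scale a (coind_scale b phi) = coind_scale (a * b) phi.
Proof.
apply/ffunP => g; rewrite !ffunE.
under eq_bigr => h _ do rewrite ffunE mulrz_suml.
under [RHS]eq_bigr => l _ do rewrite ffunE mulrz_sumr.
rewrite [RHS]exchange_big /=; apply: eq_bigr => h _.
rewrite [RHS](reindex_inj (mulgI h)) /=; apply: eq_bigr => k _.
by rewrite mulKg mulgA -mulrzA mulrC.
Qed.

Fact coind_scale1 phi : coind_scale 1 phi = phi.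
Proof.
apply/ffunP => g; rewrite ffunE (bigD1 1%g) //= big1 => [|h /negPf h1].
  by rewrite ffunE eqxx mulg1 addr0.
by rewrite ffunE h1.
Qed.

Fact coind_scaleDr : right_distributive coind_scale +%R.
Proof.
move=> a phi psi; apply/ffunP => g; rewrite !ffunE -big_split /=.
by apply: eq_bigr => h _; rewrite ffunE mulrzDl.
Qed.

Fact coind_scaleDl phi : {morph coind_scale^~ phi : a b / a + b}.
Proof.
move=> a b; apply/ffunP => g; rewrite !ffunE -big_split /=.
by apply: eq_bigr => h _; rewrite ffunE mulrzDr.
Qed.

HB.instance Definition _ := GRing.Zmodule_isLmodule.Build (group_ring gT)
  (coind gT N) coind_scaleA coind_scale1 coind_scaleDr coind_scaleDl.

Lemma coindB phi psi g : (phi - psi) g = phi g - psi g.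
Proof. by rewrite !ffunE. Qed.

Lemma coind_scale_elt h phi g : (group_elt h *: phi) g = phi (g * h)%g.
Proof.
rewrite ffunE (bigD1 h) //= big1 => [|k /negPf kh].
  by rewrite ffunE eqxx addr0.
by rewrite ffunE kh.
Qed.

End Coinduction.

Section Adjunction.
Variable gT : finGroupType.
Local Notation ZG := (group_ring gT).
Implicit Types M L : lmodType ZG.

Section MapsIn.
Variables (P : lmodType ZG) (N : zmodType) (f : P -> N).
Hypothesis fB : zmod_morphism f.

Definition coind_adj_fun (x : P) : coind gT N :=
  [ffun g => f (group_elt g *: x)].

Fact coind_adj_linear : linear coind_adj_fun.
Proof.
apply: equivariant_linear => [x y|h x]; apply/ffunP => g.
  by rewrite !ffunE scalerBr fB.
by rewrite coind_scale_elt !ffunE scalerA -group_eltM.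
Qed.

(** The ZG-linear map adjoint to f; f is recovered as evaluation at 1. *)
Definition coind_adj : {linear P -> coind gT N} :=
  bundle_linear coind_adj_linear.

Lemma coind_adjE x g : coind_adj x g = f (group_elt g *: x).
Proof. by rewrite ffunE. Qed.

End MapsIn.

Section Functoriality.
Variables (N N' : zmodType) (p : N -> N').
Hypothesis pB : zmod_morphism p.

Fact coind_map_proof : zmod_morphism (fun phi : coind gT N => p (phi 1%g)).
Proof. by move=> phi psi; rewrite !ffunE pB. Qed.

Definition coind_map : {linear coind gT N -> coind gT N'} :=
  coind_adj coind_map_proof.

Lemma coind_mapE phi g : coind_map phi g = p (phi g).
Proof. by rewrite coind_adjE coind_scale_elt mul1g. Qed.

Lemma coind_map_surj : (forall y, exists x, p x = y) ->
  forall psi, exists phi, coind_map phi = psi.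
Proof.
move=> p_surj psi; have [s sP] := choice p_surj.
by exists [ffun g => s (psi g)]; apply/ffunP => g; rewrite coind_mapE ffunE sP.
Qed.

End Functoriality.

(** Restriction has the right adjoint coind, which preserves surjections, so it
    preserves projectives: a lifting problem over Z for P is one over ZG with
    coinduced targets. *)
Lemma restriction_projective (P : lmodType ZG) :
  projective P -> projective (zmodule P).
Proof.
move=> projP N N' p f p_surj.
have fB : zmod_morphism (f : P -> N') by exact: (raddfB f).
have [h hE] := projP _ _ (coind_map (raddfB p)) (coind_adj fB)
  (coind_map_surj _ p_surj).
have gB : zmod_morphism (fun x : zmodule P => h x 1%g : N).
  by move=> x y; rewrite (raddfB h) !ffunE.
exists (bundle_int gB) => x.
have /ffunP/(_ 1%g) := hE x; rewrite coind_mapE coind_adjE group_elt1 scale1r.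
exact.
Qed.

Section MapsOut.
Variables (N : zmodType) (L : lmodType ZG) (f : N -> L).
Hypothesis fB : zmod_morphism f.

Definition coind_ext_fun (phi : coind gT N) : L :=
  \sum_h group_elt h^-1 *: f (phi h).

Fact coind_ext_linear : linear coind_ext_fun.
Proof.
apply: equivariant_linear => [phi psi|h phi]; rewrite /coind_ext_fun.
  by rewrite -sumrB; apply: eq_bigr => h _; rewrite !ffunE fB scalerBr.
rewrite scaler_sumr [RHS](reindex_inj (mulIg h)); apply: eq_bigr => k _ /=.
by rewrite coind_scale_elt scalerA -group_eltM invMg mulKVg.
Qed.

(** The ZG-linear map coind N -> L that extends f along [coind_unit], the
    inclusion of N as the functions supported at 1: the function with the value
    n at h and 0 elsewhere is the translate by h^-1 of the one with the value n
    at 1. *)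
Definition coind_ext : {linear coind gT N -> L} :=
  bundle_linear coind_ext_linear.

End MapsOut.

Definition coind_unit (N : zmodType) (n : N) : coind gT N :=
  [ffun g => if g == 1%g then n else 0].

Fact coind_unitB N : zmod_morphism (@coind_unit N).
Proof.
by move=> m n; apply/ffunP => g; rewrite !ffunE; case: ifP; rewrite ?subr0.
Qed.

Lemma coind_ext_unit (N : zmodType) phi : coind_ext (@coind_unitB N) phi = phi.
Proof.
apply/ffunP => g; rewrite sum_ffunE (bigD1 g) //= big1 => [|h hg].
  by rewrite coind_scale_elt mulgV ffunE eqxx addr0.
by rewrite coind_scale_elt ffunE -eq_mulgV1 eq_sym (negPf hg).
Qed.

Lemma coind_ext_comp (N : zmodType) L L' (f : N -> L) (f' : N -> L')
    (fB : zmod_morphism f) (fB' : zmod_morphism f') (u : {linear L -> L'}) :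
  (forall n, u (f n) = f' n) ->
  forall phi, u (coind_ext fB phi) = coind_ext fB' phi.
Proof.
move=> uf phi; rewrite [LHS]raddf_sum; apply: eq_bigr => h _.
by rewrite -uf; exact: linearZ.
Qed.

(** Induction preserves projectives, being left adjoint to restriction, which
    preserves surjections. *)
Lemma coind_projective (Q : lmodType int) :
  projective Q -> projective (coind gT Q).
Proof.
move=> projQ N N' p f p_surj.
have fuB : zmod_morphism ((fun q => f (coind_unit q)) : Q -> N').
  by move=> q r; rewrite (coind_unitB q r) [LHS]raddfB.
have fuB' : zmod_morphism ((fun q => f (coind_unit q)) : Q -> zmodule N').
  exact: fuB.
have [h hE] := projQ _ _ (zlinear p) (bundle_int fuB') p_surj.
have hB : zmod_morphism (h : Q -> N) by exact: (raddfB h).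
exists (coind_ext hB) => phi; rewrite (coind_ext_comp hB fuB hE).
rewrite -(coind_ext_comp (coind_unitB (N := Q)) fuB (u := f)) //.
by rewrite coind_ext_unit.
Qed.

Definition coind_counit M : {linear coind gT M -> M} :=
  coind_ext (fun x y : M => erefl (x - y)).

Definition coind_incl M : {linear M -> coind gT M} :=
  coind_adj (fun x y : M => erefl (x - y)).

Lemma coind_inclE M (x : M) g : coind_incl M x g = group_elt g *: x.
Proof. exact: coind_adjE. Qed.

Lemma coind_incl_inj M : injective (@coind_incl M).
Proof.
by move=> x y /ffunP/(_ 1%g); rewrite !coind_inclE group_elt1 !scale1r.
Qed.

Lemma coind_counit_surj M (x : M) : exists phi, coind_counit M phi = x.
Proof.
exists (coind_unit x); rewrite [LHS](bigD1 1%g) //= big1 => [|g /negPf g1].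
  by rewrite ffunE eqxx invg1 group_elt1 scale1r addr0.
by rewrite ffunE g1 scaler0.
Qed.

Lemma coind_restriction_projective M :
  projective (zmodule M) -> projective (zmodule (coind gT M)).
Proof.
move=> projM; apply: restriction_projective.
exact: (@coind_projective (zmodule M)).
Qed.

End Adjunction.

(** * Restriction of totally acyclic complexes *)

Section Resolutions.
Variable gT : finGroupType.
Local Notation ZG := (group_ring gT).
Implicit Types M N : lmodType ZG.

Lemma restriction_gorenstein M :
  gorenstein_projective M -> gorenstein_projective (zmodule M).
Proof.
case=> P [d [projP acP totP [iota [iota_inj iotaP]]]].
exists (fun i => zmodule (P i)), (fun i => zlinear (d i)); split.
- by move=> i; exact: restriction_projective.
- exact: acP.
- move=> Q projQ i f; split=> [fd0|[g gE] x]; last first.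
    rewrite -gE; have -> : zlinear (d (i - 1)) (zlinear (d i) x) = 0.
      by apply/(acP i); exists x.
    exact: linear0.
  have fB : zmod_morphism (f : P (i - 1) -> Q) by exact: (raddfB f).
  (* The adjoint of f factors through d (i - 1) over ZG; evaluation at 1 then
     gives the factorization of f. *)
  have [g gE] : exists g : {linear P (i - 1 - 1) -> coind gT Q},
      forall y, g (d (i - 1) y) = coind_adj fB y.
    apply/(totP _ (coind_projective (gT := gT) projQ)) => x; apply/ffunP => g.
    by rewrite coind_adjE -linearZ ffunE; exact: fd0.
  have g1B : zmod_morphism (fun y : zmodule (P (i - 1 - 1)) => g y 1%g : Q).
    by move=> x y; rewrite (raddfB g) !ffunE.
  exists (bundle_int g1B) => y; have /ffunP/(_ 1%g) := gE y.
  by rewrite coind_adjE group_elt1 scale1r.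
- by exists (zlinear iota).
Qed.

(** * Acyclic complexes of projectives are totally acyclic *)

(** Composing f with sigma extends f to an additive map on B.  To make it
    ZG-linear, view f as a map to coind Q by a section s of the counit
    coind Q -> Q, extend additively the component at 1 of s f, and return by the
    adjunction and the counit. *)
Lemma extension_through_split (A B Q : lmodType ZG) (D : {linear A -> B})
    (sigma : B -> A) (f : {linear A -> Q}) :
  zmod_morphism sigma -> (forall a, D (sigma (D a)) = D a) -> projective Q ->
  (forall a, D a = 0 -> f a = 0) ->
  exists g : {linear B -> Q}, forall a, g (D a) = f a.
Proof.
move=> sigmaB DsD projQ fker.
have [s sE] := projQ _ _ (coind_counit Q) (bundle_linear (linearP idfun))
  (@coind_counit_surj _ Q).
have uB : zmod_morphism (fun b => s (f (sigma b)) 1%g).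
  by move=> x y; rewrite sigmaB !raddfB !ffunE.
exists (bundle_linear (linearP (coind_counit Q \o coind_adj uB))) => a.
suff -> : f a = coind_counit Q (s (f a)).
  congr (coind_counit Q _); apply/ffunP => g; rewrite coind_adjE -linearZ.
  have -> : f (sigma (D (group_elt g *: a))) = group_elt g *: f a.
    rewrite -linearZ; apply/eqP; rewrite -subr_eq0 -linearB; apply/eqP/fker.
    by rewrite linearB /= DsD subrr.
  by rewrite linearZ coind_scale_elt mul1g.
by rewrite sE.
Qed.

(** With D and E two consecutive differentials, the image of E is a subgroup of
    a Z-projective group, so E has an additive section t on its image.  Then
    b - t (E b) lies in the kernel of E, which is the image of D; lifting this
    along D, by Z-projectivity of the middle term, splits D additively. *)
Lemma acyclic_Hom_acyclic (P : int -> lmodType ZG)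
  (d : forall i, {linear P i -> P (i - 1)}) :
  (forall i, projective (P i)) -> acyclic d ->
  forall Q : lmodType ZG, projective Q -> Hom_acyclic d Q.
Proof.
move=> projP acP Q projQ i f; split=> [fd0|[g gE] x]; last first.
  rewrite -gE; have -> : d (i - 1) (d i x) = 0 by apply/(acP i); exists x.
  exact: linear0.
pose B := P (i - 1 - 1); pose D := d (i - 1); pose E := d (i - 1 - 1).
have projZ j : projective (zmodule (P j)) by exact: restriction_projective.
have [q qE q_surj] := image_corestr E.
have projI : projective (zmodule (lin_image E)).
  apply: (@submodule_Zprojective _ _ (zlinear (image_incl E)) _ (projZ _)).
  exact: image_incl_inj.
have [t tE] := projI _ _ (zlinear q) (bundle_linear (linearP idfun)) q_surj.
pose r (b : B) := b - t (q b).
have rB : zmod_morphism (r : zmodule B -> zmodule B).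
  by move=> x y; rewrite /r (raddfB q) (raddfB t); exact: subrACA.
have qt b : E (t (q b)) = E b.
  by rewrite -!qE; congr (image_incl E _); exact: (tE (q b)).
have [|sigma sigmaE] :=
    @projective_lift _ _ _ _ (zlinear D) (bundle_int rB) (projZ _).
  move=> b; have /(acP (i - 1)) : E (r b) = 0.
    by apply/eqP; rewrite raddfB subr_eq0; apply/eqP; exact: esym (qt b).
  by [].
apply: (@extension_through_split _ _ _ D sigma) => //.
- exact: (raddfB sigma).
- move=> a; rewrite [LHS]sigmaE /= /r; have -> : q (D a) = 0.
    apply: image_incl_inj; rewrite qE linear0.
    by apply/(acP (i - 1)); exists a.
  by rewrite (raddf0 t) subr0.
- by move=> a Da0; have /(acP i)[x <-] := Da0; exact: fd0.
Qed.

(** * Complete resolutions of Z-projective modules *)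

Record syzygy_step M N := SyzygyStep {
  step_mid : lmodType ZG;
  step_in : {linear M -> step_mid};
  step_out : {linear step_mid -> N};
  step_projective : projective step_mid;
  step_in_inj : injective step_in;
  step_out_surj : forall y, exists x, step_out x = y;
  step_exact : forall x, step_out x = 0 <-> exists y, step_in y = x }.

Lemma splice_gorenstein (Z : int -> lmodType ZG) :
  (forall i, syzygy_step (Z i) (Z (i - 1))) -> gorenstein_projective (Z 0).
Proof.
move=> st; pose P i := step_mid (st i).
pose d i : {linear P i -> P (i - 1)} :=
  bundle_linear (linearP (step_in (st (i - 1)) \o step_out (st i))).
have projP i : projective (P i) by exact: step_projective.
have dE i x : d i x = 0 <-> step_out (st i) x = 0.
  split=> [dx0|x0]; last by rewrite /d /= x0 linear0.
  by apply: (step_in_inj (s := st (i - 1))); rewrite linear0.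
have acP : acyclic d.
  move=> i y; rewrite dE step_exact; split=> [[z <-]|[x <-]].
    by have [x <-] := step_out_surj (st i) z; exists x.
  by exists (step_out (st i) x).
exists P, d; split => //; first exact: acyclic_Hom_acyclic.
exists (step_in (st 0)); split; first exact: step_in_inj.
by move=> y; rewrite dE step_exact.
Qed.

Lemma embedded_Zprojective M N (e : {linear M -> N}) :
  injective e -> projective (zmodule N) -> projective (zmodule M).
Proof. by move=> e_inj; exact: (@submodule_Zprojective _ _ (zlinear e)). Qed.

Definition syzygy M : lmodType ZG := lin_kernel (coind_counit M).

Lemma syzygy_Zprojective M :
  projective (zmodule M) -> projective (zmodule (syzygy M)).
Proof.
move=> /coind_restriction_projective; apply: embedded_Zprojective.
exact: kernel_incl_inj.
Qed.

Lemma syzygyP M : projective (zmodule M) -> syzygy_step (syzygy M) M.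
Proof.
move=> projM.
apply: (@SyzygyStep _ _ (coind gT M) (kernel_incl _) (coind_counit M)).
- exact: (@coind_projective gT (zmodule M)).
- exact: kernel_incl_inj.
- exact: coind_counit_surj.
- exact: kernel_inclP.
Qed.

(** The difference of the two coface maps of the cobar resolution of M.  Its
    kernel is M ([coind_coface_eq0]), so its image is the cokernel of M in
    coind M, realized as a submodule of a coinduced module. *)
Definition coind_coface M : {linear coind gT M -> coind gT (coind gT M)} :=
  bundle_linear (linearP
    (coind_incl (coind gT M) \- coind_map gT (raddfB (coind_incl M)))).

Definition cosyzygy M : lmodType ZG := lin_image (coind_coface M).

Lemma coind_coface_eq0 M phi :
  coind_coface M phi = 0 <-> exists x, coind_incl M x = phi.
Proof.
have cofE g :
    coind_coface M phi g = group_elt g *: phi - coind_incl M (phi g).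
  by rewrite [LHS]coindB coind_inclE coind_mapE.
split=> [phi0|[x phiE]]; last first.
  apply/ffunP => g; rewrite cofE -phiE coind_inclE linearZ subrr.
  by rewrite ffunE.
exists (phi 1%g); apply/esym/eqP; rewrite -subr_eq0.
by rewrite -[X in X - _](scale1r phi) -group_elt1 -cofE phi0 ffunE.
Qed.

Lemma cosyzygy_Zprojective M :
  projective (zmodule M) -> projective (zmodule (cosyzygy M)).
Proof.
move=> /coind_restriction_projective/coind_restriction_projective.
by apply: embedded_Zprojective; exact: image_incl_inj.
Qed.

Lemma cosyzygyP M : projective (zmodule M) -> syzygy_step M (cosyzygy M).
Proof.
move=> projM; have [q qE q_surj] := cid2 (image_corestr (coind_coface M)).
apply: (@SyzygyStep _ _ (coind gT M) (coind_incl M) q).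
- exact: (@coind_projective gT (zmodule M)).
- exact: coind_incl_inj.
- exact: q_surj.
- move=> x; rewrite -coind_coface_eq0 -qE.
  split=> [->|qx0]; first exact: linear0.
  by apply: image_incl_inj; rewrite qx0 linear0.
Qed.

Definition syzygy_seq M (i : int) : lmodType ZG :=
  match i with
  | Posz n => iter n syzygy M
  | Negz n => iter n.+1 cosyzygy M
  end.

Lemma syzygy_seq_Zprojective M i :
  projective (zmodule M) -> projective (zmodule (syzygy_seq M i)).
Proof.
move=> projM; case: i => n /=.
  by elim: n => //= n; exact: syzygy_Zprojective.
by elim: n => [|n IHn] /=; exact: cosyzygy_Zprojective.
Qed.

Lemma syzygy_seq_step M i : projective (zmodule M) ->
  syzygy_step (syzygy_seq M i) (syzygy_seq M (i - 1)).
Proof.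
move=> projM; have projZ j : projective (zmodule (syzygy_seq M j)).
  exact: syzygy_seq_Zprojective.
case: i => [[|n]|n].
- exact: cosyzygyP.
- have -> : Posz n.+1 - 1 = n by rewrite -addn1 PoszD addrK.
  by apply: syzygyP; exact: (projZ n).
- have -> : Negz n - 1 = Negz n.+1 by rewrite !NegzE -opprD -PoszD addn1.
  exact: cosyzygyP (projZ (Negz n)).
Qed.

Lemma Zprojective_gorenstein M :
  projective (zmodule M) -> gorenstein_projective M.
Proof.
move=> projM.
exact: (splice_gorenstein (fun i => syzygy_seq_step i projM)).
Qed.

End Resolutions.

Theorem corollary2p6 (gT : finGroupType) (M : lmodType (group_ring gT)) :
  gorenstein_projective M <-> gorenstein_projective (underlying_Zmodule M).
Proof.
split; first exact: restriction_gorenstein.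
by move=> /gorenstein_Zprojective; exact: Zprojective_gorenstein.
Qed.
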